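(* Let $n\ge 2$ and $\mathfrak n\ge 1$ be integers and let $\mathbf s=\{s_{i_1,\dots,i_n}\}_{i_1,\dots,i_n=0}^{2\mathfrak n-1}$ be real numbers. For $J=(j_2,\dots,j_n)\in\{0,\dots,2\mathfrak n-1\}^{n-1}$ let $\mathfrak s_J=\{\mathfrak s_{i,j_2,\dots,j_n}\}_{i=0}^{2\mathfrak n-1}$ be the associated sequence, with normal indices $n_1^{J}<\dots<n_{N_J}^{J}$, and suppose $n_{N_J}^{J}=\mathfrak n$ for every $J$. Let $A=\{\alpha_J\}_{j_2,\dots,j_n=0}^{2\mathfrak n-1}$ be real numbers such that $\mathfrak s_J$ is $\alpha_J$-regular for every $J$. Let $m_k^{AJ},l_k^{AJ}$ be the shifted S-fraction atoms and $P^{+AJ}_{k},Q^{+AJ}_{k}$ the Stieltjes polynomials with shift $\alpha_J$, of the first and second kind, associated with $\mathfrak s_J$ (all defined in the context). Then any solution $F$ of the problem $\mathbf{MP}(\mathbf s,2\mathfrak n-1)$ has the representation $$F(z_1,\dots,z_n)=\sum_{j_2,\dots,j_n=0}^{2\mathfrak n-1}\frac{1}{\prod_{i=2}^n z_i^{j_i+1}}\cdot\cfrac{1}{-(z_1-\alpha_J)m_1^{AJ}(z_1)+\cfrac{1}{l_1^{AJ}+\cdots+\cfrac{1}{-(z_1-\alpha_J)m_{N_J}^{AJ}(z_1)+\cfrac{1}{l_{N_J}^{AJ}+\tau_J(z_1)}}}},$$ where the parameters $\tau_J$ satisfy $\tau_J(z_1)=o(1)$ as $z_1\widehat{\rightarrow}\infty$.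 Furthermore, this can be represented as $$F(z_1,\dots,z_n)=\sum_{j_2,\dots,j_n=0}^{2\mathfrak n-1}\frac{1}{\prod_{i=2}^n z_i^{j_i+1}}\;\frac{Q^{+AJ}_{2N_J-1}(z_1)\,\tau_J(z_1)+Q^{+AJ}_{2N_J}(z_1)}{P^{+AJ}_{2N_J-1}(z_1)\,\tau_J(z_1)+P^{+AJ}_{2N_J}(z_1)} .$$
   Context: **Limits.** A Stolz domain with centre $0$ and angle $\theta\in(0,\pi/2]$ is $\{z\in\mathbb C^+:\theta<\arg z<\pi-\theta\}$; $z\widehat{\rightarrow}\infty$ means $|z|\to\infty$ inside any such Stolz domain. Identities between functions of $z_1$ are understood for $z_1$ in any such Stolz domain with $|z_1|$ sufficiently large (depending on the domain), and $z_2,\dots,z_n\neq0$. **Associated sequences.** For $J=(j_2,\dots,j_n)$, $$\mathfrak s_{i,j_2,\dots,j_n}=\binom{i+j_2+\dots+j_n}{i,j_2,\dots,j_n}s_{i,j_2,\dots,j_n}\quad(\text{multinomial coefficient}).$$ **The problem $\mathbf{MP}(\mathbf s,\ell)$.** Given real numbers $\mathbf s=\{s_{i_1,\dots,i_n}\}_{i_1,\dots,i_n=0}^{\ell}$, a solution is a function of the form $$F(z_1,\dots,z_n)=\sum_{j_2,\dots,j_n=0}^{\ell}\frac{F_{j_2,\dots,j_n}(z_1)}{z_2^{j_2+1}\cdots z_n^{j_n+1}},$$ where each $F_{J}$ is a complex function on $\mathbb C^+$ with $$F_J(z_1)=-\frac{\mathfrak s_{0,j_2,\dots,j_n}}{z_1}-\dots-\frac{\mathfrak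 s_{\ell,j_2,\dots,j_n}}{z_1^{\ell+1}}+o\left(\frac1{z_1^{\ell+1}}\right),\quad z_1\widehat{\rightarrow}\infty .$$ **Objects attached to a one-dimensional real sequence** $c=\{c_i\}_{i=0}^{2\mathfrak n-1}$ and $\alpha\in\mathbb R$ (applied to $c=\mathfrak s_J$, $\alpha=\alpha_J$; superscripts $J$, $AJ$ indicate this). *Normal indices:* the integers $m$, $1\le m\le\mathfrak n$, with $D_m:=\det(c_{p+q})_{p,q=0}^{m-1}\ne0$. List them as $n_1<\dots<n_N$; assume $n_N=\mathfrak n$; put $n_0=0$ and $\nu_k=n_k-n_{k-1}$. *P-fraction atoms:* Put $c^{(0)}_i=c_i$. For $k=1,\dots,N-1$ and $0\le i\le 2\mathfrak n-2n_k-1$, $$c^{(k)}_i=\frac{(-1)^{i+\nu_k}}{\big(c^{(k-1)}_{\nu_k-1}\big)^{i+\nu_k+1}}\det(T_{pq})_{p,q=1}^{i+\nu_k+1},\qquad T_{pq}=\begin{cases}c^{(k-1)}_{\nu_k+p-q},&q\le p+1,\\0,&q>p+1.\end{cases}$$ For $k=0,\dots,N-1$, with $\nu=\nu_{k+1}$ and $D^{(k)}_\nu=\det(c^{(k)}_{p+q})_{p,q=0}^{\nu-1}$, $$b_k=c^{(k)}_{\nu-1},\qquad a_k(z)=\frac1{D^{(k)}_\nu}\begin{vmatrix}c^{(k)}_0&c^{(k)}_1&\dots&c^{(k)}_\nu\\ \vdots&\vdots&&\vdots\\ c^{(k)}_{\nu-1}&c^{(k)}_\nu&\dots&c^{(k)}_{2\nu-1}\\1&z&\dots&z^\nu\end{vmatrix}.$$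 *Polynomials of the first kind:* $P_{n_k}$ ($-1\le k\le N$) is the solution of $b_k y_{n_{k-1}}(z)-a_k(z)y_{n_k}(z)+y_{n_{k+1}}(z)=0$, $k=0,\dots,N-1$, with $P_{n_{-1}}\equiv0$, $P_{n_0}\equiv1$. *$\alpha$-regularity:* $c$ is $\alpha$-regular if $P_{n_j}(\alpha)\neq0$ for all $j=1,\dots,N$. *Shifted S-fraction atoms:* $$d^A_1=\frac1{b_0},\qquad l^A_1=-\frac1{d^A_1a_0(\alpha)},\qquad d^A_j=\frac1{b_{j-1}\,(l^A_{j-1})^2\,d^A_{j-1}},\qquad l^A_j=-\frac{l^A_{j-1}}{1+l^A_{j-1}d^A_ja_{j-1}(\alpha)},$$ $$m^A_j(z)=\frac{(a_{j-1}(z)-a_{j-1}(\alpha))\,d^A_j}{z-\alpha},\qquad 1\le j\le N;$$ $d^A_j$ is the leading coefficient of $m^A_j$. *Stieltjes polynomials with shift $\alpha$:* $P^{+A}_k$ and $Q^{+A}_k$ ($-1\le k\le 2N$) are the solutions of $$y_{2j}-y_{2j-2}=l^A_j\,y_{2j-1},\qquad y_{2j+1}-y_{2j-1}=-(z-\alpha)\,m^A_{j+1}(z)\,y_{2j}$$ with $P^{+A}_{-1}\equiv0$, $P^{+A}_0\equiv1$, $Q^{+A}_{-1}\equiv1$, $Q^{+A}_0\equiv0$. *)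

(* Defs.v *)
From HB Require Import structures.
From mathcomp Require Import all_boot all_order all_algebra.
From mathcomp Require Import boolp classical_sets filter reals topology.
From mathcomp Require Import normedtype landau trigo.
From mathcomp Require Import complex.

Set Implicit Arguments.
Unset Strict Implicit.
Unset Printing Implicit Defensive.

Import Order.TTheory GRing.Theory Num.Theory.
Import numFieldNormedType.Exports.

Local Open Scope ring_scope.
Local Open Scope classical_set_scope.
Local Open Scope complex_scope.

(* The library has no complex argument; [arg z = phi] is rendered by the polar
   form [z = `|z| * (cos phi +i* sin phi)]. *)
Definition stolz (R : realType) (theta : R) : set R[i] :=
  [set z | 0 < complex.Im z /\
    exists2 phi, theta < phi < pi - theta &
      z = `|z| * (cos phi +i* sin phi)].

Definition stolz_infty (R : realType) (theta : R) : set_system R[i] :=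
  filter_from [set: R] (fun M => [set z | stolz theta z /\ M%:C < `|z|]).

#[export] Instance stolz_infty_filter (R : realType) (theta : R) :
  Filter (stolz_infty theta).
Proof.
apply: filter_from_filter; first by exists 0.
move=> M1 M2 _ _; exists (Num.max M1 M2) => // z [Sz Mz].
have zE : `|z| = (complex.Re `|z|)%:C by rewrite normc_def.
move: Mz; rewrite zE !ltcR gt_max => /andP[M1z M2z].
by split; split => //; rewrite zE ltcR.
Qed.

Definition stolz_infty_on (R : realType) (theta : R) : filter_on R[i] :=
  FilterType (stolz_infty theta) (stolz_infty_filter theta).

(* [P z] for all [z] in any Stolz domain with [`|z|] large, the bound on [`|z|]
   depending on the domain. *)
Definition stolz_near (R : realType) (P : R[i] -> Prop) : Prop :=
  forall theta : R, 0 < theta <= pi / 2 ->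
    \forall z \near stolz_infty theta, P z.

(* The codomain is [R[i]^o] because this is the type carrying the normed module
   structure that the Landau notations need. *)
Definition stolz_littleo (R : realType) (f g : R[i] -> R[i]^o) : Prop :=
  forall theta : R, 0 < theta <= pi / 2 ->
    let S := stolz_infty_on theta in f =o_S g.

(* A multi-index (j_2, ..., j_n), each entry in {0, ..., l}, is an element of
   [multi_index n.-1 l]: its entry at [k : 'I_n.-1] is j_(k+2). *)
Notation multi_index m l := {ffun 'I_m -> 'I_l.+1}.

(* Only the values at [i <= l] are meaningful. *)
Definition assoc_seq (R : realType) (m l : nat)
    (s : 'I_l.+1 -> multi_index m l -> R) (J : multi_index m l) (i : nat) : R :=
  ((i + \sum_k J k)%N)`!%:R / (i`!%:R * \prod_k (J k)`!%:R) * s (inord i) J.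

Definition MP_solution (R : realType) (m l : nat)
    (s : 'I_l.+1 -> multi_index m l -> R)
    (F : R[i] -> ('I_m -> R[i]) -> R[i]) : Prop :=
  exists FJ : multi_index m l -> R[i] -> R[i],
    stolz_near (fun z1 : R[i] =>
      forall z : 'I_m -> R[i], (forall k, z k != 0) ->
      F z1 z = \sum_J FJ J z1 / \prod_k z k ^+ (J k).+1)
    /\ forall J, stolz_littleo
         (fun z1 => FJ J z1
            - \sum_(i < l.+1) (- ((assoc_seq s J i)%:C / z1 ^+ i.+1)))
         (fun z1 => 1 / z1 ^+ l.+1).

Section Atoms.
Variables (R : realType) (nn : nat) (c : nat -> R).

Definition hankel_det (u : nat -> R) (m : nat) : R :=
  \det (\matrix_(p < m, q < m) u (p + q)%N).

Definition normal_indices : seq nat :=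
  [seq m <- iota 1 nn | hankel_det c m != 0].

Definition nb_normal : nat := size normal_indices.

Definition normal_index (k : nat) : nat := nth 0%N (0%N :: normal_indices) k.

Definition nu (k : nat) : nat := (normal_index k - normal_index k.-1)%N.

(* Rows and columns are numbered from 0, which leaves T_pq unchanged since it
   depends on p - q only. *)
Fixpoint pseq (k : nat) : nat -> R :=
  if k is k'.+1 then
    let v := nu k in let u := pseq k' in
    fun i => (-1) ^+ (i + v) / u v.-1 ^+ (i + v).+1
      * \det (\matrix_(p < (i + v).+1, q < (i + v).+1)
                if (q <= p.+1)%N then u (v + p - q)%N else 0)
  else c.

Definition b_atom (k : nat) : R := pseq k (nu k.+1).-1.

Definition a_atom (k : nat) : {poly R} :=
  let v := nu k.+1 in
  (hankel_det (pseq k) v)^-1 *: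
    \det (\matrix_(p < v.+1, q < v.+1)
            if (p < v)%N then (pseq k (p + q)%N)%:P else 'X^q).

(* (P_(n_(k-1)), P_(n_k)) *)
Fixpoint first_kind_pair (k : nat) : {poly R} * {poly R} :=
  if k is k'.+1 then
    let: (y0, y1) := first_kind_pair k' in
    (y1, a_atom k' * y1 - b_atom k' *: y0)
  else (0, 1).

Definition first_kind (k : nat) : {poly R} := (first_kind_pair k).2.

Variable alpha : R.

Definition alpha_regular : Prop :=
  forall j, (1 <= j <= nb_normal)%N -> (first_kind j).[alpha] != 0.

(* (d_(k+1), l_(k+1)) *)
Fixpoint dl_atoms (k : nat) : R * R :=
  if k is k'.+1 then
    let: (d, l) := dl_atoms k' in
    let d' := 1 / (b_atom k * l ^+ 2 * d) in
    (d', - (l / (1 + l * d' * (a_atom k).[alpha])))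
  else
    let d := 1 / b_atom 0 in
    (d, - (1 / (d * (a_atom 0).[alpha]))).

Definition d_atom (j : nat) : R := (dl_atoms j.-1).1.

Definition l_atom (j : nat) : R := (dl_atoms j.-1).2.

(* The division by 'X - alpha is exact. *)
Definition m_atom (j : nat) : {poly R} :=
  (d_atom j *: (a_atom j.-1 - (a_atom j.-1).[alpha]%:P)) %/ ('X - alpha%:P).

(* (y_(2j-1), y_(2j)) for the solution with given y_(-1) and y_0 *)
Fixpoint stieltjes_pair (ym1 y0 : {poly R}) (j : nat) : {poly R} * {poly R} :=
  if j is j'.+1 then
    let: (y, y') := stieltjes_pair ym1 y0 j' in
    let y'' := y - ('X - alpha%:P) * m_atom j * y' in
    (y'', y' + l_atom j *: y'')
  else (ym1, y0).

Definition stieltjesP_odd : {poly R} := (stieltjes_pair 0 1 nb_normal).1.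
Definition stieltjesP_even : {poly R} := (stieltjes_pair 0 1 nb_normal).2.
Definition stieltjesQ_odd : {poly R} := (stieltjes_pair 1 0 nb_normal).1.
Definition stieltjesQ_even : {poly R} := (stieltjes_pair 1 0 nb_normal).2.

End Atoms.

Definition evalC (R : realType) (p : {poly R}) (z : R[i]) : R[i] :=
  (map_poly (real_complex R) p).[z].

(* [cfrac [:: x_1; ...; x_k] t] = 1 / (x_1 + 1 / (... + 1 / (x_k + t))) *)
Definition cfrac (K : fieldType) (xs : seq K) (t : K) : K :=
  foldr (fun x y => 1 / (x + y)) t xs.

(* No denominator of the continued fraction vanishes. *)
Fixpoint cfrac_defined (K : fieldType) (xs : seq K) (t : K) : bool :=
  if xs is x :: xs' then (x + cfrac xs' t != 0) && cfrac_defined xs' t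
  else true.

Definition S_fraction_entries (R : realType) (nn : nat) (c : nat -> R)
    (alpha : R) (z : R[i]) : seq R[i] :=
  flatten [seq [:: - ((z - alpha%:C) * evalC (m_atom nn c alpha j) z);
                  (l_atom nn c alpha j)%:C]
          | j <- iota 1 (nb_normal nn c)].

(* Main.v *)
Require Import Defs.
From HB Require Import structures.
From mathcomp Require Import all_boot all_order all_algebra.
From mathcomp Require Import boolp classical_sets filter reals topology.
From mathcomp Require Import normedtype landau trigo.
From mathcomp Require Import complex.
From mathcomp Require Import functions ring zify.

Set Implicit Arguments.
Unset Strict Implicit.
Unset Printing Implicit Defensive.

Import Order.TTheory GRing.Theory Num.Theory.
Import numFieldNormedType.Exports.

Local Open Scope ring_scope.
Local Open Scope complex_scope.

(** The terms of the sum over J do not interact, so the theorem reduces to one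
    sequence c and one function f_0 with f_0(z) = - sum_i c_i / z^(i+1) +
    o(1/z^(2 nn)) on every Stolz domain.

    The function f_0 is expanded by the Euclidean algorithm at infinity: if
    f_k ~ - sum_i u_i / z^(i+1), where u is the k-th sequence [pseq k] and
    u_(v-1) is its first nonzero entry, then - b_k / f_k is a monic polynomial
    a_k of degree v plus a remainder f_(k+1).  With x the sequence u started at
    its index v-1, and e the coefficients of the reciprocal of the power series
    sum_j x_j t^j, both a_k (reversed) and the moments of f_(k+1) are read off
    from b_k * e.  Cramer's rule for lower triangular Toeplitz matrices
    ([series_inv_conv]) turns e into the determinants that define the
    sequences [pseq k], and Cramer's rule for a bordered Hankel matrix turns
    [a_atom] into the polynomial part ([a_atom_poly]).  Each step costs 2 v
    orders of precision ([expansion_step]), so that 2 (nn - n_k) are left for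
    f_k; at k = N this is n_N = nn and f_N = o(1).

    The definitions measure v by the normal indices of the original sequence c.
    This is consistent because, up to a shift of the size by v, the Hankel
    determinants of u and of the next sequence vanish simultaneously
    ([hankel_det_next]).  Indeed both express the solvability of a Pade problem,
    q W = r modulo t^(M+m), respectively r E = q modulo t^(M+m), with W E = 1
    ([pade_swap]).

    It remains to pass from the P-fraction to the S-fraction.  The Moebius
    transformation Phi_k = l_k^2 d_k f_k / (1 - l_k d_k f_k) turns
    f_k = - b_k / (a_k + f_(k+1)) into
    Phi_k = 1 / (- (z - alpha) m_(k+1) + 1 / (l_(k+1) + Phi_(k+1)))
    for k >= 1, and Phi_0 = f_0 satisfies the same relation
    ([cf_tail_entries]); regularity at alpha makes the l_k finite and
    nonzero, because 1 / l_k = - d_k P_(n_k)(alpha) / P_(n_(k-1))(alpha)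
    ([dl_atoms_first_kind]).  The parameter is tau = Phi_N, which is o(1)
    together with f_N.  The formula with the Stieltjes polynomials is the
    convergent formula for continued fractions ([cf_pairE]). *)

(** * Reciprocals of power series and Pade duality *)

Section Series.
Variable K : fieldType.
Implicit Types (x e u : nat -> K) (p q W E : {poly K}).

(** The determinant of the Toeplitz-Hessenberg matrix with entries x_(1+p-q). *)
Definition toeplitz_det x (m : nat) : K :=
  \det (\matrix_(p < m, q < m) if (q <= p.+1)%N then x (p.+1 - q)%N else 0).

(** The coefficient of t^m in the reciprocal of the power series
    sum_j x_j t^j, when x_0 is nonzero. *)
Definition series_inv x (m : nat) : K :=
  (-1) ^+ m * toeplitz_det x m / x 0%N ^+ m.+1.

Lemma series_inv_prefix x n : x 0%N != 0 ->
  exists e, forall m, (m < n)%N ->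
    \sum_(j < m.+1) e j * x (m - j)%N = (m == 0)%:R.
Proof.
move=> x0; elim: n => [|n [e he]]; first by exists (fun=> 0).
pose v := ((n == 0)%:R - \sum_(j < n) e j * x (n - j)%N) / x 0%N.
exists (fun m => if m == n then v else e m) => m.
rewrite ltnS leq_eqVlt => /orP[/eqP -> | lt_mn]; last first.
  rewrite -he //; apply: eq_bigr => j _; rewrite ifN //.
  by have := ltn_ord j; lia.
rewrite big_ord_recr /= subnn eqxx divfK // addrC.
rewrite [X in _ + X](_ : _ = \sum_(j < n) e j * x (n - j)%N) ?subrK //.
by apply: eq_bigr => j _; have := ltn_ord j => ltj; rewrite ifN //; lia.
Qed.

(** Cramer's rule: the column of the e_k solves the lower triangular Toeplitz
    system of x with right-hand side (1, 0, ..., 0), and the minor giving its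
    last entry is the Toeplitz-Hessenberg one. *)
Lemma series_inv_unique x e m : x 0%N != 0 ->
  (forall k, (k <= m)%N ->
    \sum_(j < k.+1) e j * x (k - j)%N = (k == 0)%:R) ->
  e m = series_inv x m.
Proof.
move=> x0 he.
pose L : 'M[K]_m.+1 :=
  \matrix_(p, q) if (q <= p)%N then x (p - q)%N else 0.
have detL : \det L = x 0%N ^+ m.+1.
  rewrite det_trig; last first.
    by apply/is_trig_mxP => i j ltij; rewrite mxE leqNgt ltij.
  rewrite (eq_bigr (fun=> x 0%N)) ?prodr_const ?card_ord // => i _.
  by rewrite mxE leqnn subnn.
have Le : L *m (\col_i e i) = delta_mx 0 0.
  apply/matrixP => i j; rewrite !mxE ord1 eqxx andbT -(he i) -1?ltnS //.
  rewrite (big_ord_widen m.+1 (fun j => e j * x (i - j)%N)) //=.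
  rewrite [RHS]big_mkcond /=; apply: eq_bigr => k _.
  by rewrite !mxE ltnS; case: ifP => _; rewrite ?mul0r // mulrC.
have := congr1 (fun A : 'cV_m.+1 => A ord_max 0) (congr1 (mulmx (\adj L)) Le).
rewrite mulmxA mul_adj_mx detL mul_scalar_mx !mxE => def_em.
rewrite (bigD1 0) //= big1 ?addr0 in def_em; last first.
  by move=> i /negbTE i0; rewrite !mxE i0 mulr0.
rewrite !mxE eqxx mulr1 /cofactor add0n in def_em.
apply: (mulfI (expf_neq0 m.+1 x0)); rewrite def_em.
rewrite mulrCA divff ?expf_neq0 ?mulr1 //.
congr (_ * \det _); apply/matrixP => p q; rewrite !mxE /= /bump /= add1n.
by rewrite [(m <= _)%N]leqNgt ltn_ord add0n.
Qed.

Lemma series_inv_conv x m : x 0%N != 0 ->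
  \sum_(j < m.+1) series_inv x j * x (m - j)%N = (m == 0)%:R.
Proof.
move=> x0; have [e he] := series_inv_prefix m.+1 x0.
rewrite -(he m) //; apply: eq_bigr => j _; congr (_ * _); apply/esym.
apply: series_inv_unique => // k lekj; apply: he.
by have := ltn_ord j; lia.
Qed.

Lemma series_inv0 x : x 0%N != 0 -> series_inv x 0 = (x 0%N)^-1.
Proof. by move=> x0; rewrite /series_inv /toeplitz_det det_mx00 !mul1r. Qed.

Lemma series_inv_poly x n k : x 0%N != 0 -> (k < n)%N ->
  ((\poly_(i < n) series_inv x i) * (\poly_(i < n) x i))`_k = (k == 0)%:R.
Proof.
move=> x0 ltkn; rewrite -(series_inv_conv k x0) coefM.
apply: eq_bigr => j _; have := ltn_ord j => ltj; rewrite !coef_poly !ifT //; lia.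
Qed.

Lemma coefM_prefix n p q r : (forall k, (k < n)%N -> p`_k = q`_k) ->
  forall k, (k < n)%N -> (p * r)`_k = (q * r)`_k.
Proof.
move=> epq k ltkn; rewrite !coefM; apply: eq_bigr => j _; rewrite epq //.
by have := ltn_ord j; lia.
Qed.

(** If W E = 1 modulo t^(M+m), then q W = r modulo t^(M+m) exactly when
    q = r E modulo t^(M+m); so a nonzero q of degree below M for which q W has
    a gap from t^m on gives a nonzero r of degree below m for which r E has a
    gap from t^M on.  Exchanging W and E gives the converse. *)
Lemma pade_swap W E M m :
  (forall k, (k < M + m)%N -> (W * E)`_k = (k == 0)%:R) ->
  (exists2 q : {poly K}, q != 0 & (size q <= M)%N
     /\ forall k, (k < M)%N -> (q * W)`_(m + k) = 0) ->
  exists2 r : {poly K}, r != 0 & (size r <= m)%N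
     /\ forall k, (k < m)%N -> (r * E)`_(M + k) = 0.
Proof.
move=> WE [q q0 [szq qW]]; pose r := take_poly m (q * W).
have er k : (k < M + m)%N -> r`_k = (q * W)`_k.
  move=> ltk; rewrite coef_take_poly; case: ltnP => // lemk.
  by rewrite -(subnKC lemk) qW //; lia.
have rE k : (k < M + m)%N -> (r * E)`_k = q`_k.
  move=> ltk; rewrite (coefM_prefix E er) // -mulrA mulrC.
  rewrite (@coefM_prefix (M + m) _ 1) ?mul1r // => i lti.
  by rewrite WE // coef1.
exists r; last first.
  split=> [|k ltk]; first exact: size_take_poly.
  by rewrite rE ?ltn_add2l // nth_default // (leq_trans szq) ?leq_addr.
apply: contra_neq q0 => r0; apply/polyP => k; rewrite coef0.
case: (ltnP k M) => [ltk|lek]; last by rewrite nth_default // (leq_trans szq).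
by rewrite -rE ?ltn_addr // r0 mul0r coef0.
Qed.

End Series.

(** * Hankel determinants and one step of the P-fraction *)

Section Hankel.
Variable R : realType.
Implicit Types (u : nat -> R) (W : {poly R}).

(** A Hankel determinant of size M whose entries are, up to a factor, the
    coefficients of W shifted by M - m - 1 vanishes iff the Pade problem for W
    with degrees M and m has a nontrivial solution.  The reversal of a kernel
    vector is the list of coefficients of q. *)
Lemma hankel_eq0P u M m (kappa : R) W : kappa != 0 ->
  (forall n, (n < M + M)%N -> u n =
     if (M <= n.+1 + m)%N then kappa * W`_(n.+1 + m - M) else 0) ->
  hankel_det u M = 0 <->
  exists2 q : {poly R}, q != 0 & (size q <= M)%N
     /\ forall k, (k < M)%N -> (q * W)`_(m + k) = 0.
Proof.
move=> kap0 defu.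
have convE (q : {poly R}) (k : 'I_M) : (size q <= M)%N ->
    kappa * (q * W)`_(m + k) = \sum_(p < M) q`_(rev_ord p) * u (p + k)%N.
  move=> szq; have ltk := ltn_ord k; rewrite (reindex_inj rev_ord_inj) /=.
  rewrite (big_ord_widen (M + (m + k).+1)%N
    (fun j => q`_(M - (M - j.+1).+1) * u (M - j.+1 + k)%N)) ?leq_addr //.
  rewrite coefM (big_ord_widen (M + (m + k).+1)%N
    (fun j => q`_j * W`_(m + k - j)%N)) ?leq_addl //.
  rewrite mulr_sumr [LHS]big_mkcond [RHS]big_mkcond; apply: eq_bigr => j _ /=.
  case: (ltnP j M) => [ltj|lej]; last first.
    by rewrite nth_default ?mul0r ?mulr0 ?if_same // (leq_trans szq).
  rewrite defu; last by lia.
  rewrite (_ : (M - (M - j.+1).+1)%N = j); last by lia.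
  rewrite (_ : (M <= (M - j.+1 + k).+1 + m)%N = (j < (m + k).+1)%N); last by lia.
  case: ifP => _; last by rewrite mulr0.
  by rewrite mulrCA; congr (_ * (_ * _`_ _)); lia.
split=> [/eqP/det0P[v v0 vH] | [q q0 [szq qW]]].
  pose q := \poly_(i < M) (if insub i is Some j then v 0 (rev_ord j) else 0).
  have szq : (size q <= M)%N by exact: size_poly.
  have qE (p : 'I_M) : q`_(rev_ord p) = v 0 p.
    by rewrite coef_poly (valP (rev_ord p)) valK rev_ordK.
  exists q; last split=> // k ltk.
    apply: contra_neq v0 => q0; apply/rowP => p; rewrite -qE q0 coef0 mxE //.
  apply: (mulfI kap0); rewrite (convE q (Ordinal ltk)) // mulr0.
  have := congr1 (fun A : 'rV_M => A 0 (Ordinal ltk)) vH; rewrite !mxE.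
  move=> vH0; rewrite -[RHS]vH0.
  by apply: eq_bigr => p _; rewrite qE !mxE.
apply/eqP/det0P; exists (\row_p q`_(rev_ord p)).
  apply: contra_neq q0 => v0; apply/polyP => k; rewrite coef0.
  case: (ltnP k M) => [ltk|lek]; last by rewrite nth_default // (leq_trans szq).
  have := congr1 (fun A : 'rV_M => A 0 (rev_ord (Ordinal ltk))) v0.
  by rewrite !mxE rev_ordK.
apply/rowP => k; rewrite !mxE; transitivity (kappa * (q * W)`_(m + k)).
  rewrite convE //; apply: eq_bigr => p _; rewrite !mxE //.
by rewrite qW ?mulr0.
Qed.

(** The first nonzero entry of u is its v-th one, u_(v-1). *)
Definition leading u v :=
  (0 < v)%N /\ (forall i, (i < v.-1)%N -> u i = 0) /\ u v.-1 != 0.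

(** The sequence u started at its index v-1. *)
Definition lead_shift u v j : R := u (v.-1 + j)%N.

(** One step of the recursion for the sequences c^(k): [pseq k.+1] is
    convertible to [next_seq (pseq k) (nu k.+1)]. *)
Definition next_seq u v i : R := (-1) ^+ (i + v) / u v.-1 ^+ (i + v).+1
      * \det (\matrix_(p < (i + v).+1, q < (i + v).+1)
                if (q <= p.+1)%N then u (v + p - q)%N else 0).

Lemma next_seqE u v i : leading u v ->
  next_seq u v i = - (u v.-1 * series_inv (lead_shift u v) (v.+1 + i)).
Proof.
move=> [v0 [_ b0]]; rewrite /series_inv /lead_shift addn0.
rewrite /next_seq (_ : (v.+1 + i)%N = (i + v).+1); last by lia.
rewrite /toeplitz_det; set T := \matrix_(p < _, q < _) _.
rewrite (_ : \matrix_(p, q) _ = T); last first.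
  by apply/matrixP => p q; rewrite !mxE; case: ifP => // leqp; congr (u _); lia.
rewrite !exprS; have := expf_neq0 (i + v) b0; move: (_ ^+ _) (_ ^+ _) => B s B0.
by field; rewrite b0 B0.
Qed.

(** The Hankel determinants of u and of the next sequence vanish at the same
    sizes, up to the shift by v. *)
Lemma hankel_det_next u v m : leading u v ->
  hankel_det u (v + m) = 0 <-> hankel_det (next_seq u v) m = 0.
Proof.
move=> Lu; have [v0 [ul b0]] := Lu; set x := lead_shift u v.
have x0 : x 0%N != 0 by rewrite /x /lead_shift addn0.
pose L := ((v + m) + (v + m))%N.
pose W := \poly_(i < L) x i; pose E := \poly_(i < L) series_inv x i.
have EW k : (k < L)%N -> (E * W)`_k = (k == 0)%:R by exact: series_inv_poly.
rewrite (@hankel_eq0P u (v + m) m 1 W) ?oner_eq0 //; last first.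
  move=> n ltn; case: (leqP (v + m) (n.+1 + m)) => [le|gt]; last by apply: ul; lia.
  rewrite mul1r coef_poly ifT; last by rewrite /L; lia.
  by rewrite /x /lead_shift; congr (u _); lia.
rewrite (@hankel_eq0P (next_seq u v) m (v + m) (- u v.-1) E) ?oppr_eq0 //; last first.
  move=> n ltn; rewrite ifT; last by lia.
  rewrite coef_poly ifT; last by rewrite /L; lia.
  rewrite next_seqE // mulNr; congr (- (_ * series_inv _ _)); lia.
split; apply: pade_swap => k ltk; first by rewrite mulrC EW // /L; lia.
by rewrite EW // /L; lia.
Qed.

Lemma hankel_det0 u : hankel_det u 0 = 1.
Proof. exact: det_mx00. Qed.

Lemma hankel_det_row0 u m : (0 < m)%N -> (forall i, (i < m)%N -> u i = 0) ->
  hankel_det u m = 0.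
Proof.
case: m => // m _ u0; rewrite /hankel_det (expand_det_row _ 0) big1 // => j _.
by rewrite mxE u0 ?mul0r // add0n ltn_ord.
Qed.

(** The first normal index of u locates its first nonzero entry. *)
Lemma leading_first_normal u v : (0 < v)%N ->
  (forall m, (0 < m < v)%N -> hankel_det u m = 0) -> hankel_det u v != 0 ->
  leading u v.
Proof.
move=> v0 hlt hv.
have /existsP/= [i0 ui0] : [exists i : 'I_v, u i != 0].
  apply: contraNT hv => /existsPn h; rewrite hankel_det_row0 // => i lti.
  by have := h (Ordinal lti); rewrite negbK => /eqP.
have exu : exists i, (i < v)%N && (u i != 0) by exists i0; rewrite ltn_ord.
case: (ex_minnP exu) => i /andP[ltiv ui] mini.
(* The first nonzero entry u_i makes i + 1 a normal index by [hankel_det_next]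
   with an empty second determinant. *)
have Li : leading u i.+1.
  split=> //; split=> // k ltk; apply/eqP; case: (boolP (u k == 0)) => // uk.
  have := mini k; rewrite uk andbT => h; move: ltk (h (ltn_trans ltk ltiv)).
  by rewrite /= ltnNge => /negbTE ->.
have hi : hankel_det u i.+1 != 0.
  apply/eqP => h; have := hankel_det_next 0 Li; rewrite addn0 => -[/(_ h)].
  by rewrite hankel_det0 => /eqP; rewrite oner_eq0.
suff -> : v = i.+1 by [].
apply/eqP; rewrite eqn_leq ltiv andbT leqNgt; apply: contra hi => lti.
by rewrite hlt.
Qed.

(** The bordered Hankel determinant that defines a_k is, after normalization,
    the polynomial part of - b_k / f_k. *)
Lemma a_atom_poly u v : leading u v -> hankel_det u v != 0 ->
  (hankel_det u v)^-1 *: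
    \det (\matrix_(p < v.+1, q < v.+1)
            if (p < v)%N then (u (p + q)%N)%:P else 'X^q)
  = \poly_(j < v.+1) (u v.-1 * series_inv (lead_shift u v) (v - j)).
Proof.
move=> [v0 [ul b0]] hv; set x := lead_shift u v.
have x0 : x 0%N != 0 by rewrite /x /lead_shift addn0.
set M : 'M_ _ := (X in \det X).
(* The vector g is orthogonal to the Hankel rows, so Cramer's rule applied to
   M g gives det M in terms of g and of the corner cofactor. *)
pose g j := u v.-1 * series_inv x (v - j).
pose G := \col_(j < v.+1) (g j)%:P.
have MG : M *m G = (\poly_(j < v.+1) g j) *: delta_mx ord_max 0.
  apply/matrixP => p j; rewrite [LHS]mxE [RHS]mxE [delta_mx _ _ _ _]mxE.
  rewrite ord1 eqxx andbT; case: (unliftP ord_max p) => [p' ->|->]; last first.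
    rewrite eqxx mulr1 poly_def; apply: eq_bigr => k _.
    by rewrite !mxE ltnn mulrC mul_polyC.
  rewrite eq_sym (negbTE (neq_lift _ _)) mulr0.
  have -> : \sum_k M (lift ord_max p') k * G k 0
      = (u v.-1 * \sum_(k < v.+1) series_inv x (v - k) * u (p' + k)%N)%:P.
    rewrite mulr_sumr rmorph_sum; apply: eq_bigr => k _ /=.
    by rewrite !mxE lift_max ltn_ord /g -polyCM; congr _%:P; ring.
  rewrite (reindex_inj rev_ord_inj) /=.
  have ltp := ltn_ord p'.
  rewrite (_ : \sum_(k < v.+1) _ =
      \sum_(k < p'.+2) series_inv x k * x (p'.+1 - k)%N).
    by rewrite series_inv_conv // mulr0.
  rewrite (big_ord_widen v.+1 (fun k => series_inv x k * x (p'.+1 - k)%N)) //.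
  rewrite [RHS]big_mkcond; apply: eq_bigr => k _ /=; have ltk := ltn_ord k.
  rewrite (_ : (v - (v.+1 - k.+1))%N = k); last by lia.
  case: ltnP => lek; last by rewrite ul ?mulr0 //; lia.
  by congr (_ * _); rewrite /x /lead_shift; congr (u _); lia.
have := congr1 (fun A : 'cV_v.+1 => A ord_max 0) (congr1 (mulmx (\adj M)) MG).
rewrite mulmxA mul_adj_mx mul_scalar_mx -scalemxAr !mxE.
rewrite (bigD1 ord_max) //= big1 ?addr0; last first.
  by move=> i /negbTE i0; rewrite !mxE i0 mulr0.
rewrite !mxE eqxx mulr1 /g subnn series_inv0 // /x /lead_shift addn0 divff //.
rewrite mulr1 => ->.
have -> : cofactor M ord_max ord_max = (hankel_det u v)%:P.
  rewrite /cofactor -signr_odd addnn odd_double mul1r /hankel_det.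
  rewrite -det_map_mx; congr (\det _); apply/matrixP => p q.
  by rewrite !mxE !lift_max ltn_ord.
by rewrite mulrC mul_polyC scalerA mulVf // scale1r.
Qed.
End Hankel.

(** * Asymptotic expansions along a filter *)

(** [f] tends to 0 along the filter [F]. *)
Definition vanishes (K : numFieldType) (T : Type) (F : set_system T)
  (f : T -> K) : Prop := (f @ F --> (0 : K))%classic.

Section Asymptotics.
Local Open Scope classical_set_scope.
Variables (K : numFieldType) (T : Type) (F : set_system T) (FF : Filter F).
Variable t : T -> K.
Hypothesis t0 : vanishes F t.
Hypothesis tN0 : \forall x \near F, t x != 0.

(** f = - sum_(i < n) u_i t^(i+1) + o(t^n); at infinity, t is 1/z. *)
Definition expansion (u : nat -> K) (n : nat) (f : T -> K) : Prop :=
  vanishes F (fun x => (f x + \sum_(i < n) u i * t x ^+ i.+1) / t x ^+ n).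

Lemma cvg_horner (p : {poly K}) : (fun x => p.[t x]) @ F --> p.[0].
Proof.
elim/poly_ind: p => [|p c IH].
  rewrite horner0; under eq_fun do rewrite horner0; exact: cvg_cst.
rewrite hornerMXaddC; under eq_fun do rewrite hornerMXaddC.
apply: cvgD; last exact: cvg_cst.
by apply: cvgM.
Qed.

Lemma cvg_tX n : (fun x => t x ^+ n) @ F --> (0 : K) ^+ n.
Proof.
have := @cvg_horner 'X^n; rewrite hornerXn.
by under eq_fun do rewrite hornerXn.
Qed.

Lemma expansion_cvg0 u n f : expansion u n f -> vanishes F f.
Proof.
move=> ef; pose S := \sum_(i < n) u i *: 'X^(i.+1) : {poly K}.
have SE y : S.[y] = \sum_(i < n) u i * y ^+ i.+1.
  by rewrite horner_sum; apply: eq_bigr => i _; rewrite hornerZ hornerXn.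
have S0 : S.[0] = 0.
  by rewrite SE big1 // => i _; rewrite expr0n mulr0.
have := cvgB (cvgM ef (@cvg_tX n)) (@cvg_horner S).
rewrite S0 mul0r subr0 => /(_ FF FF) h; apply: (cvg_trans _ h).
apply: near_eq_cvg; near=> x; rewrite !fctE /=.
rewrite divfK ?SE ?addrK // expf_neq0 //.
by near: x.
Unshelve. all: end_near. Qed.

(** One step of the Euclidean algorithm at infinity, where x_j = u_(v-1+j) and
    e is the reciprocal power series of x: it lowers the order by 2 v. *)
Lemma expansion_step (x e : nat -> K) u v n f :
  (forall k, \sum_(j < k.+1) e j * x (k - j)%N = (k == 0)%:R) ->
  x 0%N != 0 -> (0 < v)%N -> (v.*2 <= n)%N ->
  (forall i, (i < n)%N -> u i = if (i < v.-1)%N then 0 else x (i - v.-1)%N) ->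
  expansion u n f ->
  (\forall y \near F, f y != 0) /\
  expansion (fun i => - (x 0%N * e (v.+1 + i)%N)) (n - v.*2)
    (fun y => - x 0%N / f y
       - (\poly_(j < v.+1) (x 0%N * e (v - j)%N)).[(t y)^-1]).
Proof.
move=> conv x0 v0 le2vn uE ef.
pose L := (n - v).+1.
pose W := \poly_(i < L) x i; pose E := \poly_(i < L) e i.
have EW k : (k < L)%N -> (E * W)`_k = (k == 0)%:R.
  move=> ltk; rewrite -conv coefM; apply: eq_bigr => j _.
  by have := ltn_ord j => ltj; rewrite !coef_poly !ifT //; lia.
(* Writing E W = 1 + t^L Q and f = t^v D, the new error term is a multiple
   of (E eps - t Q) / D, where eps is the error term of f. *)
pose Q := drop_poly L (E * W).
have EWE : E * W = 1 + Q * 'X^L.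
  rewrite -(poly_take_drop L (E * W)); congr (_ + _).
  apply/polyP => k; rewrite coef_take_poly coef1.
  by case: ltnP => [/EW //|]; case: k.
have SE y : \sum_(i < n) u i * y ^+ i.+1 = y ^+ v * W.[y].
  have -> : n = (v.-1 + L)%N by rewrite /L; lia.
  rewrite big_split_ord /= big1 ?add0r; last first.
    by move=> i _; rewrite uE ?ltn_ord ?mul0r //; have := ltn_ord i; lia.
  rewrite /W horner_poly mulr_sumr; apply: eq_bigr => i _ /=.
  rewrite uE; last by have := ltn_ord i; rewrite /L; lia.
  rewrite ifN; last by lia.
  rewrite mulrCA -exprD; congr (x _ * _ ^+ _); lia.
have EE y : y != 0 -> x 0%N * E.[y] = y ^+ v *
    ((\poly_(j < v.+1) (x 0%N * e (v - j)%N)).[y^-1]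
     - \sum_(i < n - v.*2) - (x 0%N * e (v.+1 + i)%N) * y ^+ i.+1).
  move=> y0; rewrite /E horner_poly.
  have -> : L = (v.+1 + (n - v.*2))%N by rewrite /L; lia.
  rewrite big_split_ord /= mulrDr mulrBr; congr (_ + _).
    rewrite horner_poly (reindex_inj rev_ord_inj) /= !mulr_sumr.
    apply: eq_bigr => i _; rewrite subSS mulrA [RHS]mulrCA; congr (_ * _).
    have lei : (i <= v)%N by rewrite -ltnS.
    rewrite exprVn (_ : y ^+ v = y ^+ (v - i) * y ^+ i) ?mulfK ?expf_neq0 //.
    by rewrite -exprD subnK.
  rewrite -mulrN -sumrN !mulr_sumr; apply: eq_bigr => i _.
  rewrite mulNr opprK mulrA [RHS]mulrCA -exprD; congr (_ * _ ^+ _); lia.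
pose eps y := (f y + \sum_(i < n) u i * t y ^+ i.+1) / t y ^+ n.
have eps0 : eps @ F --> (0 : K) by [].
pose D y := t y ^+ (n - v) * eps y - W.[t y].
have fE y : t y != 0 -> f y = t y ^+ v * D y.
  move=> ty0; rewrite /D mulrBr mulrA -exprD subnKC; last by lia.
  by rewrite /eps mulrC divfK ?expf_neq0 // SE addrK.
have W0 : W.[0] = x 0%N by rewrite horner_coef0 coef_poly.
have D0 : D @ F --> - x 0%N.
  have := cvgB (cvgM (@cvg_tX (n - v)) eps0) (@cvg_horner W).
  by rewrite mulr0 sub0r W0; apply.
have DN0 : \forall y \near F, D y != 0.
  by apply: (cvgr_neq0 _ D0); rewrite oppr_eq0.
split.
  near=> y; have ty0 : t y != 0 by near: y.
  rewrite fE // mulf_neq0 ?expf_neq0 //; by near: y.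
have : (fun y => - x 0%N * ((E.[t y] * eps y - t y * Q.[t y]) / D y)) @ F --> (0 : K).
  have Nx0 : - x 0%N != 0 by rewrite oppr_eq0.
  have := cvgM (@cvg_cst _ (- x 0%N) _ F FF) (cvgM (cvgB
    (cvgM (@cvg_horner E) eps0) (cvgM t0 (@cvg_horner Q))) (cvgV Nx0 D0)).
  by rewrite mulr0 !mul0r subr0 mul0r mulr0; apply.
move=> h; apply: (cvg_trans _ h); apply: near_eq_cvg; near=> y.
have ty0 : t y != 0 by near: y.
have Dy0 : D y != 0 by near: y.
have tv0 : t y ^+ v != 0 by rewrite expf_neq0.
have tn0 : t y ^+ (n - v.*2) != 0 by rewrite expf_neq0.
have DE : E.[t y] * D y = t y ^+ v * t y ^+ (n - v.*2) *
     (E.[t y] * eps y - t y * Q.[t y]) - 1.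
  have := congr1 (fun p => p.[t y]) EWE.
  rewrite hornerM hornerD hornerM hornerXn hornerC => EWy.
  rewrite /D mulrBr EWy -exprD (_ : (v + _)%N = (n - v)%N); last by lia.
  by rewrite /L exprS; ring.
rewrite fE //; move: (EE _ ty0) DE; rewrite /=.
set A := (\poly_(j < v.+1) _).[_]; set S := \sum_(i < _) _ => EA DE.
have -> : A = (x 0%N * E.[t y] + t y ^+ v * S) / t y ^+ v by rewrite EA; field.
have -> : - x 0%N * ((E.[t y] * eps y - t y * Q.[t y]) / D y)
  = - x 0%N * (E.[t y] * D y + 1) / (D y * (t y ^+ v * t y ^+ (n - v.*2))).
  by rewrite DE; field; rewrite Dy0 tv0 tn0.
by field; rewrite Dy0 tv0 tn0.
Unshelve. all: end_near. Qed.

Lemma vanishesP (f : T -> K) : vanishes F f <->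
  forall eps : K, 0 < eps -> \forall y \near F, `|f y| <= eps.
Proof. exact: cvgr0Pnorm_le. Qed.

Lemma expansionP (u : nat -> K) n (f : T -> K) :
  (forall eps : K, 0 < eps -> \forall y \near F,
     `|f y + \sum_(i < n) u i * t y ^+ i.+1| <= eps * `|t y ^+ n|) ->
  expansion u n f.
Proof.
move=> h; apply/vanishesP => eps eps0; have := h _ eps0.
apply: filterS2 tN0 => y ty0.
by rewrite normrM normfV ler_pdivrMr // normr_gt0 expf_neq0.
Qed.

Lemma mobius_cvg0 (a c : K) (f : T -> K) : vanishes F f ->
  (\forall y \near F, 1 - c * f y != 0) /\
  vanishes F (fun y => a * f y / (1 - c * f y)).
Proof.
move=> f0.
have den : (fun y => 1 - c * f y) @ F --> (1 : K).
  have := cvgB (@cvg_cst _ (1 : K) _ F FF) (cvgM (@cvg_cst _ c _ F FF) f0).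
  by rewrite mulr0 subr0; apply.
split; first exact: (cvgr_neq0 _ den (oner_neq0 _)).
have := cvgM (cvgM (@cvg_cst _ a _ F FF) f0) (cvgV (oner_neq0 _) den).
by rewrite mulr0 mul0r; apply.
Qed.
End Asymptotics.

(** * Finite continued fractions *)

Section ContinuedFraction.
Variable K : fieldType.
Implicit Types (xs : seq K) (t : K) (p : K * K).

(** The last two terms of the solution of y_k = y_(k-2) + x_k y_(k-1) with
    (y_(-1), y_0) = p, where the x_k are the entries of the list. *)
Definition cf_pair p xs : K * K := foldl (fun q x => (q.2, q.1 + x * q.2)) p xs.

Lemma cf_pair_cat p xs ys : cf_pair p (xs ++ ys) = cf_pair (cf_pair p xs) ys.
Proof. exact: foldl_cat. Qed.

(** The convergent formula; D is the product of all the denominators of the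
    continued fraction, and does not depend on the initial values. *)
Lemma cf_pairE xs t : cfrac_defined xs t ->
  exists2 D, D != 0 & forall y y',
    (cf_pair (y, y') xs).1 * t + (cf_pair (y, y') xs).2
      = D * (y * cfrac xs t + y').
Proof.
elim: xs => [|x xs IH] /=.
  by exists 1; rewrite ?oner_eq0 // => y y'; rewrite mul1r.
move=> /andP[den0 /IH[D D0 DE]]; exists (D * (x + cfrac xs t)) => [|y y'].
  by rewrite mulf_neq0.
by rewrite DE /=; field.
Qed.

(* Here indices start at 0: [A k] and [A0 k] are the values of a_k at z and at
   alpha, [d k] and [l k] are d_(k+1) and l_(k+1). *)
Variables (N : nat) (A A0 b d l f : nat -> K).
Hypothesis b0 : forall k, (k < N)%N -> b k != 0.
Hypothesis l0 : forall k, (k < N)%N -> l k != 0.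
Hypothesis d0 : forall k, (k < N)%N -> d k != 0.
Hypothesis f0 : forall k, (k < N)%N -> f k != 0.
Hypothesis d_init : d 0 = 1 / b 0.
Hypothesis l_init : (l 0)^-1 = - (d 0 * A0 0).
Hypothesis d_step : forall k, (k.+1 < N)%N -> d k.+1 = 1 / (b k.+1 * l k ^+ 2 * d k).
Hypothesis l_step : forall k, (k.+1 < N)%N ->
  (l k.+1)^-1 = - (l k)^-1 - d k.+1 * A0 k.+1.
Hypothesis f_step : forall k, (k < N)%N -> f k.+1 = - b k / f k - A k.
Hypothesis den0 : forall k, (k < N)%N -> 1 - l k * d k * f k.+1 != 0.

(** The tail Phi_k of the S-fraction in terms of the tail f_k of the
    P-fraction. *)
Definition cf_tail (k : nat) : K :=
  if k is k'.+1 then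
    l k' ^+ 2 * d k' * f k / (1 - l k' * d k' * f k)
  else f 0.

(** The entries of the S-fraction with numbers k+1, ..., k+m. *)
Definition cf_entries (k m : nat) : seq K :=
  flatten [seq [:: - (d j.-1 * (A j.-1 - A0 j.-1)); l j.-1] | j <- iota k.+1 m].

Lemma cf_tail_entries m k : (k + m = N)%N ->
  cfrac_defined (cf_entries k m) (cf_tail N) /\
  cfrac (cf_entries k m) (cf_tail N) = cf_tail k.
Proof.
elim: m k => [|m IH] k kmN; first by rewrite addn0 in kmN; rewrite kmN.
have ltk : (k < N)%N by lia.
have [def eq] := IH k.+1 ltac:(lia).
rewrite /= -/(cf_entries k.+1 m) eq def andbT.
have b0k := b0 ltk; have l0k := l0 ltk; have d0k := d0 ltk.
have f0k := f0 ltk; have den0k := den0 ltk; have fk := f_step ltk.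
have lphi : l k + cf_tail k.+1 = l k / (1 - l k * d k * f k.+1).
  by rewrite /=; field.
have lphi0 : l k + cf_tail k.+1 != 0 by rewrite lphi mulf_neq0 // invr_eq0.
have inv : 1 / (l k + cf_tail k.+1) = (l k)^-1 - d k * f k.+1.
  by rewrite lphi; field; rewrite l0k den0k.
have val : - (d k * (A k - A0 k)) + 1 / (l k + cf_tail k.+1) = (cf_tail k)^-1.
  rewrite inv fk; clear kmN IH def eq lphi lphi0 inv fk.
  case: k ltk b0k l0k d0k f0k den0k => [|k] ltk b0k l0k d0k f0k den0k.
    by rewrite l_init d_init /=; field; rewrite b0k f0k.
  have ltk' : (k < N)%N by lia.
  have l0k' := l0 ltk'; have d0k' := d0 ltk'; have den0k' := den0 ltk'.
  rewrite l_step // /= d_step //; field.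
  by rewrite f0k l0k' d0k' b0k den0k'.
have tail0 : cf_tail k != 0.
  clear kmN IH def eq lphi lphi0 inv fk val b0k l0k d0k den0k.
  case: k ltk f0k => // k ltk f0k.
  have ltk' : (k < N)%N by lia.
  by rewrite /= !mulf_neq0 ?expf_neq0 ?invr_eq0 ?l0 ?d0 ?den0.
rewrite lphi0 andbT val invr_eq0; split; first by [].
by rewrite div1r invrK.
Qed.
End ContinuedFraction.

(** * Complex values of real polynomials *)

Section Evaluation.
Variable R : realType.

Lemma evalCD (p q : {poly R}) z : evalC (p + q) z = evalC p z + evalC q z.
Proof. by rewrite /evalC rmorphD hornerD. Qed.

Lemma evalCN (p : {poly R}) z : evalC (- p) z = - evalC p z.
Proof. by rewrite /evalC rmorphN hornerN. Qed.

Lemma evalCM (p q : {poly R}) z : evalC (p * q) z = evalC p z * evalC q z.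
Proof. by rewrite /evalC rmorphM hornerM. Qed.

Lemma evalC_C (r : R) z : evalC r%:P z = r%:C.
Proof. by rewrite /evalC map_polyC hornerC. Qed.

Lemma evalC0 z : evalC 0 z = 0 :> R[i].
Proof. exact: (evalC_C 0). Qed.

Lemma evalC1 z : evalC 1 z = 1 :> R[i].
Proof. exact: (evalC_C 1). Qed.

Lemma evalCX z : evalC 'X z = z :> R[i].
Proof. by rewrite /evalC map_polyX hornerX. Qed.
End Evaluation.

(** * Normal indices and P-fraction atoms of one sequence *)

Section OneSequence.
Variables (R : realType) (nn : nat) (c : nat -> R).
Hypothesis nn0 : (0 < nn)%N.
Hypothesis cN : normal_index nn c (nb_normal nn c) = nn.
Local Notation N := (nb_normal nn c).
Local Notation ni := (normal_index nn c).
Local Notation cs := (pseq nn c).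

Lemma nb_normal_gt0 : (0 < N)%N.
Proof.
rewrite lt0n; apply/eqP => N0; move: cN; rewrite N0 /normal_index /=.
by move=> nn00; move: nn0; rewrite -nn00.
Qed.

Lemma normal_indices_sorted : sorted ltn (0%N :: normal_indices nn c).
Proof.
have -> : (0 :: normal_indices nn c)%N
    = [seq m <- iota 0 nn.+1 | (m == 0)%N || (hankel_det c m != 0)].
  rewrite /= /normal_indices; congr (_ :: _); apply: eq_in_filter => m.
  by rewrite mem_iota; case: m.
by apply: sorted_filter; [exact: ltn_trans | exact: iota_ltn_sorted].
Qed.

Lemma normal_index_lt i j : (i < j)%N -> (j <= N)%N -> (ni i < ni j)%N.
Proof.
move=> ltij lejN; rewrite /normal_index.
by apply: (sorted_ltn_nth ltn_trans 0%N normal_indices_sorted) => //;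
  rewrite inE /= ltnS -/(nb_normal nn c) ?(leq_trans (ltnW ltij)).
Qed.

Lemma normal_index_le j : (j <= N)%N -> (ni j <= nn)%N.
Proof.
rewrite leq_eqVlt => /orP[/eqP->|ltj]; first by rewrite cN.
by have := normal_index_lt ltj (leqnn _); rewrite cN; exact: ltnW.
Qed.

Lemma hankel_normal_index k : (k < N)%N -> hankel_det c (ni k.+1) != 0.
Proof.
move=> ltk; have : ni k.+1 \in normal_indices nn c by exact: mem_nth.
by rewrite mem_filter => /andP[].
Qed.

Lemma hankel_between k m : (k < N)%N -> (ni k < m < ni k.+1)%N ->
  hankel_det c m = 0.
Proof.
move=> ltk /andP[ltm mlt]; apply/eqP; apply: contraTT isT => hm.
have : m \in normal_indices nn c.
  by rewrite mem_filter hm mem_iota; have := normal_index_le ltk; lia.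
move/(nthP 0%N) => [i lti mE]; have mi : m = ni i.+1 by [].
have : (k < i.+1)%N.
  rewrite ltnNge; apply/negP; rewrite leq_eqVlt => /orP[/eqP e|h].
    by move: ltm; rewrite mi e ltnn.
  by have := @normal_index_lt _ _ h (ltnW ltk); lia.
have : (i.+1 < k.+1)%N.
  rewrite ltnNge; apply/negP; rewrite leq_eqVlt => /orP[/eqP e|h].
    by move: mlt; rewrite mi -e ltnn.
  by have := @normal_index_lt _ _ h lti; lia.
lia.
Qed.

Lemma nuE k : (k < N)%N -> (ni k + nu nn c k.+1 = ni k.+1)%N.
Proof. by move=> ltk; rewrite /nu /= subnKC // ltnW // normal_index_lt. Qed.

(** The hypothesis on Hankel determinants is the induction hypothesis of
    [hankel_pseq]. *)
Lemma leading_pseq_of k : (k < N)%N ->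
  (forall m, hankel_det (cs k) m = 0 <-> hankel_det c (ni k + m) = 0) ->
  leading (cs k) (nu nn c k.+1).
Proof.
move=> ltk hk; have nk := nuE ltk.
apply: leading_first_normal.
- by have := @normal_index_lt k k.+1 (leqnn _) ltk; lia.
- move=> m ltm; apply/hk; apply: (hankel_between ltk); lia.
- apply/eqP => /hk; rewrite nk => /eqP; apply/negP; exact: hankel_normal_index.
Qed.

(** The normal indices of c^(k) are those of c beyond n_k, shifted by n_k. *)
Lemma hankel_pseq k m : (k <= N)%N ->
  hankel_det (cs k) m = 0 <-> hankel_det c (ni k + m) = 0.
Proof.
elim: k m => [|k IH] m lek //.
have hk m' := IH m' (ltnW lek).
have Lk := leading_pseq_of lek hk.
have := hankel_det_next m Lk; rewrite hk addnA nuE // => ->.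
by [].
Qed.

Lemma leading_pseq k : (k < N)%N -> leading (cs k) (nu nn c k.+1).
Proof. by move=> ltk; apply: leading_pseq_of => // m; exact/hankel_pseq/ltnW. Qed.

Lemma b_atom_neq0 k : (k < N)%N -> b_atom nn c k != 0.
Proof. by move=> /leading_pseq[_ []]. Qed.

Lemma a_atomE k : (k < N)%N -> a_atom nn c k = \poly_(j < (nu nn c k.+1).+1)
   (b_atom nn c k * series_inv (lead_shift (cs k) (nu nn c k.+1)) (nu nn c k.+1 - j)).
Proof.
move=> ltk; apply: a_atom_poly; first exact: leading_pseq.
apply/eqP => /hankel_pseq -/(_ (ltnW ltk)); rewrite nuE //.
by apply/eqP; exact: hankel_normal_index.
Qed.

(** * The successive tails of a solution *)

Section TailAsymptotics.
Variables (F : set_system R[i]) (FF : Filter F).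
Hypothesis tcv : vanishes F (fun z : R[i] => z^-1).
Hypothesis zN0 : \forall z \near F, z != 0.
Variable f0 : R[i] -> R[i].

(** The tails f_k of the P-fraction expansion of [f0]. *)
Fixpoint tail_fun (k : nat) : R[i] -> R[i] :=
  if k is k'.+1 then
    fun z => - (b_atom nn c k')%:C / tail_fun k' z - evalC (a_atom nn c k') z
  else f0.
Let t (z : R[i]) : R[i] := z^-1.
Hypothesis f0E : expansion F t (fun i => (c i)%:C) nn.*2 f0.

Lemma tail_expansion_step k : (k < N)%N ->
  expansion F t (fun i => (cs k i)%:C) (nn - ni k).*2 (tail_fun k) ->
  (\forall z \near F, tail_fun k z != 0) /\
  expansion F t (fun i => (cs k.+1 i)%:C) (nn - ni k.+1).*2 (tail_fun k.+1).
Proof.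
move=> ltk ek; have Lk := leading_pseq ltk; have [v0 [ul b0]] := Lk.
set v := nu nn c k.+1 in Lk v0 ul b0 *.
set x := lead_shift (cs k) v.
have x0 : x 0%N = b_atom nn c k by rewrite /x /lead_shift addn0.
have xN0 : x 0%N != 0 by rewrite x0.
have nk := nuE ltk; have nle := normal_index_le ltk.
have tN0 : \forall z \near F, t z != 0.
  by apply: filterS zN0 => z; rewrite /t invr_eq0.
have conv j : \sum_(i < j.+1) (series_inv x i)%:C * (x (j - i)%N)%:C
    = (j == 0)%:R :> R[i].
  rewrite -(rmorph_nat (real_complex R)) -(series_inv_conv j xN0) rmorph_sum.
  by apply: eq_bigr => i _; exact/esym/(rmorphM (real_complex R)).
have [] := @expansion_step _ _ _ FF t tcv tN0 (fun i => (x i)%:C)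
   (fun i => (series_inv x i)%:C) (fun i => (cs k i)%:C) v _ _ conv _ v0 _ _ ek.
- by rewrite fmorph_eq0.
- by rewrite leq_double; rewrite /v; lia.
- move=> i lti; case: ltnP => [/ul -> // | le].
  by rewrite /x /lead_shift subnKC.
move=> fk0 ek1; split=> //; move: ek1.
rewrite -doubleB (_ : (nn - ni k - v = nn - ni k.+1)%N); last by rewrite /v; lia.
rewrite /expansion; congr (vanishes F _); apply/funext => z /=.
congr ((_ + _) / _).
  congr (_ - _); first by rewrite x0.
  rewrite /evalC a_atomE // -/v -/x -x0 /t invrK; congr _.[z].
  apply/polyP => j; rewrite coef_map /= !coef_poly; case: ifP => _ //.
  exact/esym/(rmorphM (real_complex R)).
apply: eq_bigr => i _; congr (_ * _); rewrite -/(cs k.+1 i).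
have -> : cs k.+1 i = - (x 0%N * series_inv x (v.+1 + i)).
  by rewrite x0; exact: next_seqE.
rewrite (rmorphN (real_complex R)); congr (- _).
exact/esym/(rmorphM (real_complex R)).
Qed.

Lemma tail_expansion k : (k <= N)%N ->
  expansion F t (fun i => (cs k i)%:C) (nn - ni k).*2 (tail_fun k).
Proof.
elim: k => [|k IH] lek; first by rewrite /normal_index /= subn0.
by case: (tail_expansion_step lek (IH (ltnW lek))).
Qed.

Lemma tail_neq0 k : (k < N)%N -> \forall z \near F, tail_fun k z != 0.
Proof.
by move=> ltk; case: (tail_expansion_step ltk (tail_expansion (ltnW ltk))).
Qed.

Lemma tail_cvg0 k : (k <= N)%N -> vanishes F (tail_fun k).
Proof.
move=> lek; apply: (expansion_cvg0 FF tcv _ (tail_expansion lek)).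
by apply: filterS zN0 => z; rewrite /t invr_eq0.
Qed.
End TailAsymptotics.

(** * Shifted S-fraction atoms and the Stieltjes polynomials *)

Section ShiftedAtoms.
Variable alpha : R.
Hypothesis creg : alpha_regular nn c alpha.
Local Notation P k := (first_kind nn c k).[alpha].
Local Notation d k := (d_atom nn c alpha k.+1).
Local Notation l k := (l_atom nn c alpha k.+1).
Local Notation a k := (a_atom nn c k).
Local Notation b k := (b_atom nn c k).

Lemma first_kind_neq0 k : (k <= N)%N -> P k != 0.
Proof.
case: k => [|k] lek; last exact: creg.
by rewrite /first_kind /= hornerC oner_eq0.
Qed.

Lemma first_kindSS k :
  first_kind nn c k.+2 = a k.+1 * first_kind nn c k.+1 - b k.+1 *: first_kind nn c k.
Proof. by rewrite /first_kind /=; case: first_kind_pair. Qed.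

Lemma first_kindSS_alpha k : P k.+2 = (a k.+1).[alpha] * P k.+1 - b k.+1 * P k.
Proof. by rewrite first_kindSS hornerD hornerN hornerM (hornerZ (b k.+1)). Qed.

Lemma d_atomSS k : d k.+1 = 1 / (b k.+1 * l k ^+ 2 * d k).
Proof. by rewrite /d_atom /l_atom /=; case: dl_atoms. Qed.

Lemma l_atomSS k : l k.+1 = - (l k / (1 + l k * d k.+1 * (a k.+1).[alpha])).
Proof. by rewrite d_atomSS /d_atom /l_atom /=; case: dl_atoms. Qed.

(** Regularity keeps the shifted atoms finite and nonzero: the inverse of l_k is,
    up to the factor - d_k, a ratio of values at alpha of polynomials of the
    first kind. *)
Lemma dl_atoms_first_kind k : (k < N)%N ->
  [/\ d k != 0, l k != 0 & (l k)^-1 = - (d k * P k.+1 / P k)].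
Proof.
elim: k => [|k IH] ltk.
  have b0 := b_atom_neq0 ltk; have := first_kind_neq0 ltk.
  rewrite /d_atom /l_atom /first_kind /= !mulr1 scaler0 subr0 hornerC divr1 => a0.
  by rewrite !div1r invr_eq0 oppr_eq0 invr_eq0 mulf_neq0 ?invr_eq0 // invrN invrK.
have [d0 l0 linv] := IH (ltnW ltk).
have b0 := b_atom_neq0 ltk; have P0 := first_kind_neq0 (ltnW (ltnW ltk)).
have P1 := first_kind_neq0 (ltnW ltk); have := first_kind_neq0 ltk.
rewrite first_kindSS_alpha => P2.
have d10 : d k.+1 != 0.
  by rewrite d_atomSS div1r invr_eq0 (mulf_neq0 (mulf_neq0 b0 (expf_neq0 2 l0)) d0).
have lE : l k = - (P k / (d k * P k.+1)).
  by rewrite -[LHS]invrK linv; field; rewrite P0 d0 P1.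
have l1inv : (l k.+1)^-1 =
    - (d k.+1 * ((a k.+1).[alpha] * P k.+1 - b k.+1 * P k) / P k.+1).
  rewrite l_atomSS invrN invf_div d_atomSS lE; field.
  by rewrite P0 P1 b0 d0.
split; [exact: d10 | | exact: l1inv].
have : (l k.+1)^-1 != 0.
  by rewrite l1inv oppr_eq0 (mulf_neq0 (mulf_neq0 d10 P2)) // invr_eq0.
by rewrite invr_eq0.
Qed.

Lemma l_atom_invS k : (k.+1 < N)%N ->
  (l k.+1)^-1 = - (l k)^-1 - d k.+1 * (a k.+1).[alpha].
Proof.
move=> ltk; have [d0 l0 _] := dl_atoms_first_kind (ltnW ltk).
by rewrite l_atomSS invrN invf_div; field.
Qed.

Lemma l_atom_inv0 : (l 0)^-1 = - (d 0 * (a 0).[alpha]).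
Proof. by rewrite /l_atom /d_atom /= invrN div1r invrK. Qed.

Lemma m_atomE k : ('X - alpha%:P) * m_atom nn c alpha k.+1
   = d k *: (a k - (a k).[alpha]%:P).
Proof.
rewrite mulrC divpK // dvdp_XsubCl rootE hornerZ hornerD hornerN hornerC.
by rewrite subrr mulr0.
Qed.

Lemma m_atom_evalC k z : (z - alpha%:C) * evalC (m_atom nn c alpha k.+1) z
   = (d k)%:C * (evalC (a k) z - ((a k).[alpha])%:C).
Proof.
have := congr1 (fun p => evalC p z) (m_atomE k).
by rewrite -mul_polyC !evalCM !(evalCD, evalCN, evalC_C, evalCX).
Qed.

Lemma S_fraction_entriesE z : S_fraction_entries nn c alpha z =
  cf_entries (fun k => evalC (a k) z) (fun k => ((a k).[alpha])%:C)
    (fun k => (d k)%:C) (fun k => (l k)%:C) 0 N.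
Proof.
rewrite /S_fraction_entries /cf_entries; congr flatten; apply/eq_in_map => j.
by rewrite mem_iota => /andP[]; case: j => // j _ _; rewrite m_atom_evalC.
Qed.

(** The recurrence of the Stieltjes polynomials is the one of the convergents of
    the S-fraction. *)
Lemma stieltjes_cf_pair (y y' : {poly R}) z :
  let r := stieltjes_pair nn c alpha y y' N in
  (evalC r.1 z, evalC r.2 z)
    = cf_pair (evalC y z, evalC y' z) (S_fraction_entries nn c alpha z).
Proof.
rewrite /S_fraction_entries; elim: N => [//|j IH].
rewrite -addn1 iotaD map_cat flatten_cat cf_pair_cat -IH.
rewrite addn1 add1n /=; case: stieltjes_pair => u w /=.
rewrite -mul_polyC !(evalCD, evalCN, evalCM, evalC_C, evalCX).
by congr (_, _); ring.
Qed.

(** The parameter tau = Phi_N; the atoms l_N and d_N have 0-based index N-1. *)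
Definition tau_fun (f0 : R[i] -> R[i]) (z : R[i]) : R[i] :=
  (l N.-1)%:C ^+ 2 * (d N.-1)%:C * tail_fun f0 N z
    / (1 - (l N.-1)%:C * (d N.-1)%:C * tail_fun f0 N z).

(** Both representations of [f0 z] hold at every point [z] at which the tails
    [f_k] and the denominators of their Moebius transforms do not vanish. *)
Lemma solution_at (f0 : R[i] -> R[i]) z :
  (forall k : 'I_N, tail_fun f0 k z != 0 /\
     1 - (l k)%:C * (d k)%:C * tail_fun f0 k.+1 z != 0) ->
  let t := tau_fun f0 z in
  let num := evalC (stieltjesQ_odd nn c alpha) z * t
             + evalC (stieltjesQ_even nn c alpha) z in
  let den := evalC (stieltjesP_odd nn c alpha) z * t
             + evalC (stieltjesP_even nn c alpha) z in
  [/\ cfrac_defined (S_fraction_entries nn c alpha z) t,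
      f0 z = cfrac (S_fraction_entries nn c alpha z) t,
      den != 0 & f0 z = num / den].
Proof.
move=> gz t num den.
have f_neq0 k (ltk : (k < N)%N) := (gz (Ordinal ltk)).1.
have den_neq0 k (ltk : (k < N)%N) := (gz (Ordinal ltk)).2.
have C0 (r : R) : r != 0 -> r%:C != 0 by move=> r0; rewrite fmorph_eq0.
have CV (r : R) : (r^-1)%:C = r%:C^-1 by exact: (fmorphV (real_complex R)).
have CM (r s : R) : (r * s)%:C = r%:C * s%:C by exact: (rmorphM (real_complex R)).
have CN (r : R) : (- r)%:C = - r%:C by exact: (rmorphN (real_complex R)).
have tE : t = cf_tail (fun k => (d k)%:C) (fun k => (l k)%:C)
                (fun k => tail_fun f0 k z) N.
  by rewrite /t /tau_fun; case: (nb_normal nn c) nb_normal_gt0.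
have [] := @cf_tail_entries _ N (fun k => evalC (a k) z)
    (fun k => ((a k).[alpha])%:C) (fun k => (b k)%:C) (fun k => (d k)%:C)
    (fun k => (l k)%:C) (fun k => tail_fun f0 k z) _ _ _ _ _ _ _ _ _ _ N 0%N (add0n N).
- by move=> k /b_atom_neq0/C0.
- by move=> k ltk; have [_ /C0] := dl_atoms_first_kind ltk.
- by move=> k ltk; have [/C0] := dl_atoms_first_kind ltk.
- exact: f_neq0.
- by rewrite /d_atom /= div1r CV div1r.
- by rewrite -CV l_atom_inv0 CN CM.
- by move=> k ltk; rewrite d_atomSS div1r CV div1r !CM.
- move=> k ltk; rewrite -!CV l_atom_invS // -CM -!CN.
  exact: (rmorphD (real_complex R)).
- by [].
- exact: den_neq0.
rewrite -S_fraction_entriesE -tE /= => def val.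
have [D D0 DE] := cf_pairE def.
have denE : den = D.
  have e := stieltjes_cf_pair 0 1 z; rewrite evalC0 evalC1 in e.
  have [e1 e2] := (congr1 fst e, congr1 snd e).
  rewrite /den (etrans (congr2 (fun p q => p * t + q) e1 e2) (DE 0 1)).
  by rewrite mul0r add0r mulr1.
have numE : num = D * f0 z.
  have e := stieltjes_cf_pair 1 0 z; rewrite evalC0 evalC1 in e.
  have [e1 e2] := (congr1 fst e, congr1 snd e).
  rewrite /num (etrans (congr2 (fun p q => p * t + q) e1 e2) (DE 1 0)).
  by rewrite mul1r addr0 val.
split; [exact: def | by rewrite val | by rewrite denE |].
by rewrite numE denE mulrAC divff ?mul1r.
Qed.
End ShiftedAtoms.
End OneSequence.

(** * Stolz domains and the representation theorem *)

Section StolzFilter.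
Variables (R : realType) (theta : R).

Lemma stolz_infty_inv : vanishes (stolz_infty theta) (fun z : R[i] => z^-1).
Proof.
apply/vanishesP => eps eps0.
have epsE : eps = (complex.Re eps)%:C.
  by case: eps eps0 => x y; rewrite ltcE /= => /andP[/eqP -> _].
exists (complex.Re eps)^-1 => // z [_]; rewrite normfV => ltz.
have e0 : 0 < complex.Re eps by move: eps0; rewrite ltcE => /andP[].
have ltzV : ((complex.Re eps)%:C)^-1 < `|z|.
  by rewrite -(fmorphV (real_complex R)).
have epsV0 : 0 < ((complex.Re eps)%:C)^-1 by rewrite invr_gt0 -epsE.
rewrite epsE -[leRHS]invrK lef_pV2 ?posrE ?ltW //.
exact: lt_trans ltzV.
Qed.

Lemma stolz_infty_neq0 : \forall z \near stolz_infty theta, z != 0.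
Proof. by exists 0 => // z [_]; rewrite normr_gt0. Qed.
End StolzFilter.

Theorem theorem4p7 (R : realType) (n nn : nat) (hn : (2 <= n)%N)
    (hnn : (1 <= nn)%N)
    (s : 'I_(2 * nn - 1).+1 -> multi_index n.-1 (2 * nn - 1) -> R)
    (hnormal : forall J,
       normal_index nn (assoc_seq s J) (nb_normal nn (assoc_seq s J)) = nn)
    (alpha : multi_index n.-1 (2 * nn - 1) -> R)
    (hregular : forall J, alpha_regular nn (assoc_seq s J) (alpha J))
    (F : R[i] -> ('I_n.-1 -> R[i]) -> R[i])
    (hF : MP_solution s F) :
  exists tau : multi_index n.-1 (2 * nn - 1) -> R[i] -> R[i],
    [/\ forall J, stolz_littleo (tau J) (fun=> 1),
      stolz_near (fun z1 : R[i] =>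
        (forall J, cfrac_defined
           (S_fraction_entries nn (assoc_seq s J) (alpha J) z1) (tau J z1)) /\
        forall z : 'I_n.-1 -> R[i], (forall k, z k != 0) ->
        F z1 z = \sum_(J : multi_index n.-1 (2 * nn - 1)) 1 / (\prod_k z k ^+ (J k).+1)
          * cfrac (S_fraction_entries nn (assoc_seq s J) (alpha J) z1)
                  (tau J z1))
      & stolz_near (fun z1 : R[i] =>
        (forall J,
           evalC (stieltjesP_odd nn (assoc_seq s J) (alpha J)) z1 * tau J z1
           + evalC (stieltjesP_even nn (assoc_seq s J) (alpha J)) z1 != 0) /\
        forall z : 'I_n.-1 -> R[i], (forall k, z k != 0) ->
        F z1 z = \sum_(J : multi_index n.-1 (2 * nn - 1)) 1 / (\prod_k z k ^+ (J k).+1)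
          * ((evalC (stieltjesQ_odd nn (assoc_seq s J) (alpha J)) z1 * tau J z1
              + evalC (stieltjesQ_even nn (assoc_seq s J) (alpha J)) z1)
             / (evalC (stieltjesP_odd nn (assoc_seq s J) (alpha J)) z1
                  * tau J z1
                + evalC (stieltjesP_even nn (assoc_seq s J) (alpha J)) z1)))].
Proof.
have [FJ [FE Fasy]] := hF.
pose c J := assoc_seq s J.
pose tau J := tau_fun nn (c J) (alpha J) (FJ J).
have expF J theta : 0 < theta <= pi / 2 -> expansion (stolz_infty theta)
    (fun z : R[i] => z^-1) (fun i => (c J i)%:C) nn.*2 (FJ J).
  move=> htheta; apply: expansionP.
    by apply: filterS (stolz_infty_neq0 theta) => z; rewrite invr_eq0.
  move=> eps eps0; have := Fasy J theta htheta => /= /eqoP /(_ eps eps0).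
  apply: filterS => z; rewrite (_ : (2 * nn - 1).+1 = nn.*2); last by lia.
  rewrite sumrN opprK div1r -exprVn; congr (`|_ + _| <= _).
  by apply: eq_bigr => i _; rewrite exprVn.
have tau0 J theta : 0 < theta <= pi / 2 -> vanishes (stolz_infty theta) (tau J).
  move=> htheta; rewrite /tau /tau_fun.
  have := tail_cvg0 hnn (hnormal J) _ (stolz_infty_inv theta)
    (stolz_infty_neq0 theta) (expF J theta htheta) (leqnn _).
  move=> /(_ (stolz_infty_filter theta)) h.
  exact: (mobius_cvg0 (stolz_infty_filter theta) _ _ h).2.
have good theta : 0 < theta <= pi / 2 -> \forall z \near stolz_infty theta,
   forall J (k : 'I_(nb_normal nn (c J))), tail_fun nn (c J) (FJ J) k z != 0 /\
     1 - (l_atom nn (c J) (alpha J) k.+1)%:C * (d_atom nn (c J) (alpha J) k.+1)%:C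
         * tail_fun nn (c J) (FJ J) k.+1 z != 0.
  move=> htheta; apply: filter_forall => J; apply: filter_forall => k.
  apply: filterI.
    exact: (tail_neq0 hnn (hnormal J) _ (stolz_infty_inv theta)
      (stolz_infty_neq0 theta) (expF J theta htheta)).
  have := tail_cvg0 hnn (hnormal J) _ (stolz_infty_inv theta)
    (stolz_infty_neq0 theta) (expF J theta htheta) (ltn_ord k).
  move=> /(_ (stolz_infty_filter theta)) h.
  exact: (mobius_cvg0 (stolz_infty_filter theta) 0 _ h).1.
have sol J z := @solution_at _ _ _ hnn (hnormal J) _ (hregular J) (FJ J) z.
exists tau; split.
- move=> J theta htheta S; apply/eqoP => eps eps0.
  have /vanishesP /(_ _ eps0) := tau0 J theta htheta.
  by apply: filterS => z; rewrite normr1 mulr1.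
- move=> theta htheta; apply: filterS2 (good theta htheta) (FE theta htheta).
  move=> z gz Fz; split=> [J|w w0]; first by case: (sol J z (gz J)).
  rewrite Fz //; apply: eq_bigr => J _; case: (sol J z (gz J)) => _ <- _ _.
  by rewrite mulrC div1r.
- move=> theta htheta; apply: filterS2 (good theta htheta) (FE theta htheta).
  move=> z gz Fz; split=> [J|w w0]; first by case: (sol J z (gz J)).
  rewrite Fz //; apply: eq_bigr => J _; case: (sol J z (gz J)) => _ _ _ <-.
  by rewrite mulrC div1r.
Qed.
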